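(* Let $f$ and $g$ be permutable transcendental entire functions of bounded type. Suppose $f(\mathrm{Sing}(g^{-1}))\subset\mathrm{Sing}(g^{-1})$ and $g(\mathrm{Sing}(f^{-1}))\subset\mathrm{Sing}(f^{-1})$. Then $\mathcal{P}(f\circ g)\subset\mathcal{P}(f)\cup\mathcal{P}(g)$.
   Context: Functions $f,g$ are permutable if $f\circ g=g\circ f$. For a transcendental entire function $f$, $\mathrm{Sing}(f^{-1})$ is the set of critical values and (finite) asymptotic values of $f$ and their finite limit points; $f$ is of bounded type if $\mathrm{Sing}(f^{-1})$ is bounded. The postsingular set of $f$ is $\mathcal{P}(f)=\overline{\bigcup_{n\ge 0}f^n(\mathrm{Sing}(f^{-1}))}$ (closure in $\mathbb{C}$), where $f^n$ is the $n$-th iterate and $f^0$ is the identity. *)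

(* Defs.v *)
From HB Require Import structures.
From mathcomp Require Import all_boot all_order all_algebra.
From mathcomp Require Import complex.
From mathcomp Require Import all_classical all_reals all_analysis.

Set Implicit Arguments.
Unset Strict Implicit.
Unset Printing Implicit Defensive.

Import Order.TTheory GRing.Theory Num.Theory.
Import numFieldNormedType.Exports.

Local Open Scope classical_set_scope.
Local Open Scope ring_scope.

(* The complex plane, as a normed space over the field R[i] itself: the scalars
   in [derivable] and [derive1] below are complex, so these are the complex
   derivative and not a real directional one. *)
Notation cplane R := (R[i]^o).

Section singular_sets.
Context {R : realType}.
Local Notation C := (cplane R).
Implicit Types f g : C -> C.

Definition permutable f g := f \o g = g \o f.

Definition entire f := forall z : C, derivable f z 1.

Definition transcendental_entire f :=
  entire f /\ ~ exists p : {poly R[i]}, forall z : C, f z = p.[z].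

Definition critical_values f : set C := f @` [set z | derive1 f z = 0].

(* [a] is an asymptotic value of [f] when [f] tends to [a] along a curve
   [0, +oo[ -> C tending to infinity; the values of [gamma] at negative times
   are irrelevant.  The order on R[i] only compares numbers with the same
   imaginary part, so divergence is expressed with the real modulus [normc]. *)
Definition asymptotic_values f : set C :=
  [set a | exists gamma : R -> C,
     [/\ {within `[0, +oo[, continuous gamma},
         ComplexField.Normc.normc (gamma t) @[t --> +oo] --> +oo &
         f (gamma t) @[t --> +oo] --> a]].

(* Sing(f^-1) *)
Definition singular_set f : set C :=
  let S := critical_values f `|` asymptotic_values f in S `|` limit_point S.

Definition bounded_type f := bounded_set (singular_set f).

Definition postsingular_set f : set C :=
  closure (\bigcup_(n in [set: nat]) (iter n f @` singular_set f)).

End singular_sets.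

(* Main.v *)
Require Import Defs.
From mathcomp Require Import all_boot all_order all_algebra.
From mathcomp Require Import complex.
From mathcomp Require Import all_classical all_reals all_analysis.
From mathcomp Require Import lra.

(* The crux is that an asymptotic value a of f o g along a curve gamma is a
   critical value of f, an asymptotic value of f, or the image under f of an
   asymptotic value of g.  If a is not a critical value, f' does not vanish on
   f^-1(a), so |f z - a| >= c |z - w| near each w in f^-1(a); hence the curve
   g o gamma either tends to infinity or, as soon as it comes close enough to an
   accumulation point w, can no longer cross a small circle around w and
   converges to w.  Since Sing(f^-1) is closed and f(Sing(g^-1)) is compact, it
   follows that Sing((f o g)^-1) is contained in Sing(f^-1) u f(Sing(g^-1)),
   and this is iterated by means of (f o g)^n = f^n o g^n = g^n o f^n. *)

Import Order.TTheory GRing.Theory Num.Theory.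
Import numFieldNormedType.Exports.
Local Open Scope classical_set_scope.
Local Open Scope ring_scope.

Local Notation normc := ComplexField.Normc.normc.

(** * Topology of the plane through the real modulus *)

Section complex_topology.
Set Implicit Arguments.
Unset Strict Implicit.
Context {R : realType}.
Local Notation C := (cplane R).

Lemma norm_normcE (z : C) : `|z| = (normc z)%:C%C.
Proof. by case: z. Qed.

Lemma ltc_normc (z : C) (e : R) : (`|z| < (e%:C)%C :> C) = (normc z < e).
Proof. by rewrite norm_normcE ltcR. Qed.

Lemma normc_distC (y z : C) : normc (y - z) = normc (z - y).
Proof. by apply/(@complexI R); rewrite -!norm_normcE distrC. Qed.

(** A positive element of [R[i]] has zero imaginary part, so the complex radii of the norm topology
    reduce to real ones. *)
Lemma gt0_complexP (e : C) : 0 < e -> exists2 r : R, 0 < r & e = r%:C%C.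
Proof.
by case: e => a b; rewrite ltcE /= => /andP[/eqP-> a0]; exists a.
Qed.

Lemma cvg_normcP {T : Type} (F : set_system T) {FF : Filter F}
    (u : T -> C) (a : C) :
  u x @[x --> F] --> a <->
  forall e : R, 0 < e -> \forall x \near F, normc (a - u x) < e.
Proof.
split=> [/cvgrPdist_lt ua e e0|ua].
  have e0' : 0 < (e%:C)%C :> C by rewrite ltcR.
  by near=> x; rewrite -ltc_normc; near: x; exact: ua.
apply/cvgrPdist_lt => e /gt0_complexP[r r0 ->].
by near=> x; rewrite ltc_normc; near: x; exact: ua.
Unshelve. all: by end_near. Qed.

Lemma nbhs_normcP (z : C) (U : set C) :
  nbhs z U <-> exists2 e : R, 0 < e & forall y, normc (z - y) < e -> U y.
Proof.
split=> [/(nbhs_ballP z U)[e /= /gt0_complexP[r r0 ->] zU]|[e e0 zU]].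
  by exists r => // y zy; apply: zU; rewrite -ball_normE /= ltc_normc.
apply/(nbhs_ballP z U); exists (e%:C)%C; first by rewrite /= ltcR.
by move=> y; rewrite -ball_normE /= ltc_normc; exact: zU.
Qed.

Lemma normc_distD (y x z : C) : normc (x - z) <= normc (x - y) + normc (y - z).
Proof. by rewrite -(subrKA y x (- z)); exact: le_normcD. Qed.

Lemma continuous_normcB (w : C) : continuous (fun z : C => normc (z - w)).
Proof.
move=> z; apply/(@cvgrPdist_lt _ _ _ (nbhs z)) => e e0.
apply/nbhs_normcP; exists e => // y; apply: le_lt_trans.
rewrite ler_norml lerNl opprB !lerBlDr normc_distD andbT.
by rewrite [normc (z - y)]normc_distC normc_distD.
Qed.

(** [A] is a closed subset of the image of the compact square [I] x [I] under the continuous map (x,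
    y) |-> x + iy. *)
Lemma compact_closed_bounded (A : set C) (M : R) :
  closed A -> (forall z, A z -> normc z <= M) -> compact A.
Proof.
move=> Acl AM; pose F (p : R * R) : C := (p.1 +i* p.2)%C.
have cF : continuous F.
  move=> [x y]; apply/cvg_normcP => e e0.
  near=> p.
  have -> : F (x, y) - F p = ((x - p.1) +i* (y - p.2))%C by [].
  apply: (@le_lt_trans _ _ (`|x - p.1| + `|y - p.2|)).
    rewrite -[leRHS]ger0_norm ?addr_ge0// -sqrtr_sqr ler_wsqrtr//.
    rewrite [leRHS]sqrrD !real_normK ?num_real//.
    by rewrite addrAC lerDl mulrn_wge0// mulr_ge0.
  rewrite [ltRHS]splitr ltrD//; near: p.
    apply: (@cvgrPdist_lt _ _ _ (nbhs (x, y)) _ (fun p => p.1) x).1.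
      exact: cvg_fst.
    exact: divr_gt0.
  apply: (@cvgrPdist_lt _ _ _ (nbhs (x, y)) _ (fun p => p.2) y).1.
    exact: cvg_snd.
  exact: divr_gt0.
pose I := `[- M, M]%classic.
apply: (@subclosed_compact _ _ (F @` (I `*` I))) => //.
  apply: continuous_compact; first exact: continuous_subspaceT.
  by apply: compact_setX; exact: segment_compact.
move=> [x y] /AM /= xyM; exists (x, y) => //=.
have bnd (u v : R) : Num.sqrt (u ^+ 2 + v ^+ 2) <= M -> I u.
  move=> uvM; rewrite /I /= in_itv /= -ler_norml; apply: le_trans uvM.
  by rewrite -sqrtr_sqr ler_wsqrtr// lerDl sqr_ge0.
by split => /=; [exact: bnd xyM|apply: (bnd y x); rewrite addrC].
Unshelve. all: by end_near. Qed.

Lemma bounded_closed_compact_cplane (A : set C) :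
  bounded_set A -> closed A -> compact A.
Proof.
move=> [M [/complex_realP[k ->] AM]] Acl.
(* [AM] only provides bounds strictly above [k], hence [k + 1]. *)
apply: (@compact_closed_bounded _ (k + 1)) => // z Az.
by rewrite -lecR -norm_normcE; apply: AM => //; rewrite ltcR ltrDl.
Qed.

End complex_topology.

(** * Singular values of a composition *)

Section singular_set_comp.
Set Implicit Arguments.
Unset Strict Implicit.
Context {R : realType}.
Local Notation C := (cplane R).
Implicit Types f g : C -> C.

(** The closure of [S] consists of its isolated and limit points, and limit points form a closed set
    in a T1 space. *)
Lemma closed_singular_set f : closed (singular_set f).
Proof.
rewrite /singular_set /=; set S := critical_values f `|` _.
have hC : accessible_space C
  by apply: hausdorff_accessible; exact: norm_hausdorff.
rewrite /closed closureU => z [|/(limit_point_closed S hC)]; last by right.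
by rewrite closure_isolated_limit_point => -[/isolatedS|]; [left|right].
Qed.

Lemma entire_continuous f : entire f -> continuous f.
Proof.
by move=> fe z; apply: differentiable_continuous; exact/derivable1_diffP.
Qed.

(** This turns the composition of differentials in the chain rule into a product of derivatives. *)
Lemma linear_mulr1 (L : {linear C -> C}) (a : C) : L a = L 1 * a.
Proof. by rewrite -[a in LHS]mulr1 [in LHS](linearZZ L a 1) [RHS]mulrC. Qed.

Lemma derive1_diff f (z : C) : differentiable f z -> derive1 f z = 'd f z 1.
Proof. by move=> df; rewrite derive1E deriveE. Qed.

Lemma derive1_comp_entire f g (z : C) : entire f -> entire g ->
  derive1 (f \o g) z = derive1 f (g z) * derive1 g z.
Proof.
move=> fe ge.
have df : differentiable f (g z) by exact/derivable1_diffP.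
have dg : differentiable g z by exact/derivable1_diffP.
rewrite (derive1_diff (differentiable_comp dg df)).
rewrite (derive1_diff df) (derive1_diff dg).
transitivity ('d f (g z) ('d g z 1)).
  exact: (congr1 (fun F : C -> C => F 1) (diff_comp dg df)).
exact: linear_mulr1.
Qed.

Lemma critical_values_comp f g : entire f -> entire g ->
  critical_values (f \o g) `<=` critical_values f `|` f @` critical_values g.
Proof.
move=> fe ge _ [z /= + <-]; rewrite derive1_comp_entire// => /eqP.
rewrite mulf_eq0 => /orP[|] /eqP dz; first by left; exists (g z).
by right; exists (g z) => //; exists z.
Qed.

(** The difference quotient at [w] tends to [D], so near [w] its modulus is at least half that of
    [D]. *)
Lemma derive1_neq0_lower_bound f (w : C) :
  derivable f w 1 -> derive1 f w != 0 ->
  exists c r : R, [/\ 0 < c, 0 < r &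
    forall z, normc (w - z) < r -> c * normc (w - z) <= normc (f w - f z)].
Proof.
move=> dfw; rewrite derive1E; set D := 'D_1 f w => D0.
have nD0 : 0 < normc D by rewrite -ltcR -norm_normcE normr_gt0.
have /cvg_normcP/(_ (normc D / 2)) : h^-1 *: ((f \o shift w) (h *: 1) - f w)
  @[h --> (0 : C)^'] --> D by exact: dfw.
rewrite divr_gt0// => /(_ isT) /nbhs_normcP[r r0 rD].
exists (normc D / 2), r; split => //; first exact: divr_gt0.
move=> z wz; have [->|zw] := eqVneq z w.
  by rewrite !subrr ComplexField.Normc.normc0 mulr0.
have {rD} := rD (z - w); rewrite sub0r opprB => /(_ wz).
have zw0 : z - w != 0 by rewrite subr_eq0.
move=> /(_ zw0); rewrite /= [_ *: 1]mulr1 subrK => Dlt.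
have : normc D / 2 <= normc ((z - w)^-1 *: (f z - f w)).
  have := normc_distD ((z - w)^-1 *: (f z - f w)) D 0; rewrite !subr0.
  lra.
rewrite [_ *: _]mulrC ComplexField.Normc.normcM ComplexField.Normc.normcV.
rewrite ler_pdivlMr; last by rewrite -ltcR -norm_normcE normr_gt0.
by rewrite (normc_distC w) (normc_distC (f w)).
Qed.

Lemma frequently_bounded_cluster (h : R -> C) :
  ~ (normc (h t) @[t --> +oo] --> +oo) ->
  exists w, forall (e T : R), 0 < e -> exists2 t, T <= t & normc (w - h t) < e.
Proof.
move=> /cvgryPge/existsNP[M hM].
pose K := [set z : C | normc z <= M].
have K_compact : compact K.
  apply: (@compact_closed_bounded _ _ M) => //.
  have -> : K = (fun z : C => normc (z - 0)) @^-1` [set x | x <= M].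
    by apply/seteqP; split=> z /=; rewrite subr0.
  move/continuous_closedP : (@continuous_normcB R 0); apply.
  exact: closed_le.
(* Only the times at which [h] lies in the disc [K] are kept. This filter is proper because such
   times are unbounded; its cluster point in [K] is [w]. *)
pose F := h @ within (h @^-1` K) +oo%R.
have F_proper : ProperFilter F.
  apply: fmap_proper_filter; apply: Build_ProperFilter_ex => P hP.
  apply: contrapT => /forallNP PN; apply: hM.
  near=> t; rewrite leNgt; apply/negP => /ltW htM.
  by apply: (PN t); move: htM; near: t; exact: hP.
have FK : F K by rewrite /F nbhs_simpl /within /=; near=> t.
have [w [_ Fw]] := K_compact F F_proper FK.
exists w => e T e0.
have [||_ [[t /= Tt <-] wt]] :=
  Fw (h @` [set t | T <= t]) [set z | normc (w - z) < e].
- rewrite /F nbhs_simpl /within /=; near=> t => _.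
  by exists t => //=; near: t; apply: nbhs_pinfty_ge; rewrite num_real.
- by apply/nbhs_normcP; exists e.
- by exists t.
Unshelve. all: by end_near. Qed.

Lemma lift_asymptotic_path f (a : C) (h : R -> C) :
  continuous f -> (forall z, f z = a -> derivable f z 1 /\ derive1 f z != 0) ->
  {within `[0, +oo[, continuous h} -> f (h t) @[t --> +oo] --> a ->
  normc (h t) @[t --> +oo] --> +oo \/
  exists2 w, f w = a & h t @[t --> +oo] --> w.
Proof.
move=> fc fa hc fha.
have [|/frequently_bounded_cluster[w hw]] :=
  pselect (normc (h t) @[t --> +oo] --> +oo); [by left|right].
have fw : f w = a.
  (* Eventually [f (h t)] is near [a], and at arbitrarily late times it is near [f w]; so these two
     points cannot be separated. *)
  apply/esym/norm_hausdorff => A B /fha [T [_ TA]] /fc /nbhs_normcP[e e0 eB].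
  have [t Tt wt] := hw e (T + 1) e0.
  by exists (f (h t)); split; [apply: TA; lra|exact: eB].
exists w; first exact: fw.
have [dfw dfw0] := fa _ fw.
have [c [r [c0 r0 cr]]] := derive1_neq0_lower_bound dfw dfw0.
have r20 : 0 < r / 2 by rewrite divr_gt0.
move/cvg_normcP : fha => fha.
(* On the circle of radius [r / 2] around [w], [f] stays at distance at least [c * (r / 2)] from
   [a], so the curve cannot meet it after time [T]. *)
have [T [_ TfH]] := fha (c * (r / 2)) (mulr_gt0 c0 r20).
(* The maximum with 0 keeps [t0] where [h] is continuous; [T + 1] makes [t0] strictly later than
   [T]. *)
have [t0 Tt0 wt0] := hw (r / 2) (Num.max 0 (T + 1)) r20.
move: Tt0; rewrite ge_max => /andP[t0_ge0 Tt0].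
have trapped t : t0 <= t -> normc (w - h t) < r / 2.
  move=> t0t; rewrite ltNge; apply/negP => rt.
  have hcw : {within `[t0, t], continuous (fun s => normc (h s - w))}.
    apply: (@within_continuous_comp _ _ _ _ h (fun z : C => normc (z - w))).
      by move=> z _; exact: continuous_normcB.
    apply: continuous_subspaceW hc => s /=.
    by rewrite !in_itv /= andbT => /andP[t0s _]; exact: le_trans t0s.
  have [|s] := IVT (v := r / 2) t0t hcw.
    by rewrite ge_min le_max ![normc (h _ - w)]normc_distC (ltW wt0) rt orbT.
  rewrite in_itv /= => /andP[t0s _]; rewrite normc_distC => ws.
  have := cr (h s); rewrite ws fw => /(_ ltac:(lra)).
  by rewrite leNgt TfH//; lra.
apply/cvg_normcP => e e0.
near=> t.
(* Once trapped, the curve obeys the lower bound, which carries convergence of [f (h t)] to [a] back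
   to [h t]. *)
rewrite -(ltr_pM2l c0); apply: (@le_lt_trans _ _ (normc (a - f (h t)))).
  rewrite -fw; apply: cr; apply: lt_trans (trapped t _) _; last by lra.
  by near: t; apply: nbhs_pinfty_ge; rewrite num_real.
by near: t; apply: fha; exact: mulr_gt0.
Unshelve. all: by end_near. Qed.

Lemma asymptotic_values_comp f g : entire f -> entire g ->
  asymptotic_values (f \o g) `<=`
    critical_values f `|` asymptotic_values f `|` f @` asymptotic_values g.
Proof.
move=> fe ge a [gamma [cgamma gammay fga]].
have [|aNcv] := pselect (critical_values f a); first by left; left.
have cg : {within `[0, +oo[, continuous (g \o gamma)}.
  apply: (@within_continuous_comp _ _ _ _ gamma g) cgamma => z _.
  exact: entire_continuous ge z.
have fa z : f z = a -> derivable f z 1 /\ derive1 f z != 0.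
  move=> fz; split; first exact: fe.
  by apply/eqP => dfz; apply: aNcv; exists z.
have [ggy|[w fw gw]] := lift_asymptotic_path (entire_continuous fe) fa cg fga.
- by left; right; exists (g \o gamma).
- by right; exists w => //; exists gamma.
Qed.

Lemma singular_set_comp f g : entire f -> entire g -> bounded_type g ->
  singular_set (f \o g) `<=` singular_set f `|` f @` singular_set g.
Proof.
move=> fe ge gb.
set U := _ `|` f @` _.
(* Closedness lets [U] absorb limit points; the boundedness of [singular_set g] is what makes its
   image under [f] compact. *)
have Ucl : closed U.
  apply: closedU; first exact: closed_singular_set.
  apply: compact_closed; first exact: norm_hausdorff.
  apply: continuous_compact.
    by apply: continuous_subspaceT; exact: entire_continuous.
  by apply: bounded_closed_compact_cplane => //; exact: closed_singular_set.
have SU : critical_values (f \o g) `|` asymptotic_values (f \o g) `<=` U.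
  move=> z [/(critical_values_comp fe ge)|/(asymptotic_values_comp fe ge)].
    move=> [fz|[w gw <-]]; first by left; left; left.
    by right; exists w => //; left; left.
  move=> [[fz|fz]|[w gw <-]]; [left; left; left|left; left; right|] => //.
  by right; exists w => //; left; right.
move=> z [/SU//|/subset_limit_point/(closureS SU)]; exact: Ucl.
Qed.

End singular_set_comp.

(** * Iterates of commuting maps and the postsingular set *)

Section postsingular.
Set Implicit Arguments.
Unset Strict Implicit.
Context {T : Type}.
Implicit Types f g : T -> T.

Lemma iter_stable f (A : set T) n x : f @` A `<=` A -> A x -> A (iter n f x).
Proof.
by move=> fA Ax; elim: n => //= n IHn; apply: fA; exists (iter n f x).
Qed.

Lemma iter_comp_commute f g n : f \o g = g \o f ->
  iter n (f \o g) = iter n f \o iter n g.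
Proof.
move=> fg; have fgE x : f (g x) = g (f x) by rewrite -[LHS]/((f \o g) x) fg.
have fgn m x : iter m f (g x) = g (iter m f x).
  by elim: m => //= m ->; exact: fgE.
by apply/funext; elim: n => [|n IHn] x; rewrite ?iterS ?IHn /= ?fgn.
Qed.

End postsingular.

Theorem lemma3p1 (R : realType) (f g : cplane R -> cplane R)
  (f_te : transcendental_entire f) (g_te : transcendental_entire g)
  (f_bt : bounded_type f) (g_bt : bounded_type g)
  (fg_perm : permutable f g)
  (f_sing_g : f @` singular_set g `<=` singular_set g)
  (g_sing_f : g @` singular_set f `<=` singular_set f) :
  postsingular_set (f \o g) `<=` postsingular_set f `|` postsingular_set g.
Proof.
(* Closure commutes with finite unions, so it suffices to compare the orbits before closing. *)
rewrite /postsingular_set -closureU; apply: closureS.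
have sing_fg : singular_set (f \o g) `<=` singular_set f `|` singular_set g.
  move=> z /(singular_set_comp f_te.1 g_te.1 g_bt).
  by case; [left|right; exact: f_sing_g].
move=> _ [n _ [z /sing_fg [Sz|Sz] <-]].
  (* The inner iterate of [g] keeps [z] in [singular_set f], leaving an n-th iterate of [f] at a
     singular value of [f]. *)
  left; exists n => //; rewrite (iter_comp_commute n fg_perm).
  by exists (iter n g z); first exact: (iter_stable n g_sing_f Sz).
(* Here the factors are swapped first, so that the iterate of [g] is outermost. *)
right; exists n => //; rewrite fg_perm (iter_comp_commute n (esym fg_perm)).
by exists (iter n f z); first exact: (iter_stable n f_sing_g Sz).
Qed.
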